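(* Let $G$ be a connected graph with at least two vertices. Then for every vertex $v\in V(G)$, $\kappa(\hat G_v)>\kappa(\tilde G_v)$, where $\tilde G_v$ is the graph obtained from $G$ by adding two new vertices $a,b$ and the edges $va$ and $vb$, and $\hat G_v$ is the graph obtained from $\tilde G_v$ by adding the edge $ab$.
   Context: All graphs are finite, simple, undirected and unweighted. For a connected graph $H$ on $n$ vertices with adjacency matrix $A$ and diagonal degree matrix $D=\mathrm{diag}(Ae)$ ($e$ the all-ones vector), let $T=D^{-1}A$ be the transition matrix of the simple random walk on $H$, with spectrum $\{1,\lambda_2,\dots,\lambda_n\}$. The Kemeny's constant of $H$ is $\kappa(H)=\sum_{i=2}^n \frac{1}{1-\lambda_i}$. *)

(* Defs.v *)
From mathcomp Require Import all_boot all_order all_algebra.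

Set Implicit Arguments.
Unset Strict Implicit.
Unset Printing Implicit Defensive.

Import Order.TTheory GRing.Theory Num.Theory.
Local Open Scope ring_scope.

(* A simple graph is encoded as a symmetric, irreflexive relation on a finite type. *)

Definition connected_graph (V : finType) (e : rel V) : Prop :=
  forall x y : V, connect e x y.

Definition add_edge (V : finType) (e : rel V) (a b : V) : rel V :=
  [rel x y | [|| e x y, (x == a) && (y == b) | (x == b) && (y == a)]].

(* The vertices of V are the [inl _]; the two new ones are [inr false] and
   [inr true], isolated in [add_two_vertices e]. *)
Definition add_two_vertices (V : finType) (e : rel V) : rel (V + bool)%type :=
  fun x y => if (x, y) is (inl x', inl y') then e x' y' else false.

Definition tilde_graph (V : finType) (e : rel V) (v : V) :
    rel (V + bool)%type :=
  add_edge (add_edge (add_two_vertices e) (inl v) (inr false))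
           (inl v) (inr true).

Definition hat_graph (V : finType) (e : rel V) (v : V) : rel (V + bool)%type :=
  add_edge (tilde_graph e v) (inr false) (inr true).

Lemma add_edge_sym (V : finType) (e : rel V) (a b : V) :
  symmetric e -> symmetric (add_edge e a b).
Proof.
move=> es x y; rewrite /add_edge /= es; congr (_ || _).
by rewrite [RHS]orbC andbC [in X in _ || X]andbC.
Qed.

Lemma add_edge_irr (V : finType) (e : rel V) (a b : V) :
  a != b -> irreflexive e -> irreflexive (add_edge e a b).
Proof.
move=> ab ei x; rewrite /add_edge /= ei /= [(x == b) && _]andbC orbb.
by apply/negbTE; apply: contra ab => /andP[/eqP <- /eqP <-].
Qed.

Lemma tilde_graph_simple (V : finType) (e : rel V) (v : V) :
  symmetric e -> irreflexive e ->
  symmetric (tilde_graph e v) /\ irreflexive (tilde_graph e v).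
Proof.
move=> es ei; split.
  by do 2!apply: add_edge_sym; case=> [x|x] [y|y] //=; apply: es.
by do 2!apply: add_edge_irr => //; case=> [x|x] //=; apply: ei.
Qed.

Lemma hat_graph_simple (V : finType) (e : rel V) (v : V) :
  symmetric e -> irreflexive e ->
  symmetric (hat_graph e v) /\ irreflexive (hat_graph e v).
Proof.
move=> es ei; have [ts ti] := tilde_graph_simple v es ei.
by split; [apply: add_edge_sym | apply: add_edge_irr].
Qed.

Section Kemeny.
Variables (C : numClosedFieldType) (V : finType) (e : rel V).

Definition adjacency_mx : 'M[C]_#|V| :=
  \matrix_(i, j) (e (enum_val i) (enum_val j))%:R.

Definition degree_mx : 'M[C]_#|V| :=
  diag_mx (adjacency_mx *m const_mx 1 : 'cV_#|V|)^T.

Definition transition_mx : 'M[C]_#|V| := invmx degree_mx *m adjacency_mx.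

End Kemeny.

(* The eigenvalues of M, listed with algebraic multiplicity. *)
Definition spectrum (C : numClosedFieldType) (n : nat) (M : 'M[C]_n) : seq C :=
  sval (closed_field_poly_normal (char_poly M)).

Lemma spectrumP (C : numClosedFieldType) (n : nat) (M : 'M[C]_n) :
  char_poly M = \prod_(x <- spectrum M) ('X - x%:P).
Proof.
rewrite /spectrum; case: closed_field_poly_normal => r /= {1}->.
by rewrite (monicP (char_poly_monic M)) scale1r.
Qed.

(* [rem 1] deletes a single occurrence of the eigenvalue 1.  The constant is a
   real element of C when e is a connected graph; [<] on C entails that the
   difference of its two sides is real. *)
Definition kemeny (C : numClosedFieldType) (V : finType) (e : rel V) : C :=
  \sum_(x <- rem 1 (spectrum (transition_mx C e))) (1 - x)^-1.

(* Main.v *)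
Require Import Defs.
From mathcomp Require Import all_boot all_order all_algebra.
From mathcomp Require Import perm ring lra.

(* With L the Laplacian and D the degree matrix, det(L + t D) = c1 t + c2 t^2 + ...
   and the Kemeny constant is c2 / c1.  Write g0 + g1 t + ... for the (v, v)
   cofactor of L + t D and M for the sum of the degrees; then c1 = M g0.
   Eliminating the two new vertices expresses the two new determinants through
   these coefficients, and the difference of the two Kemeny constants becomes
     (6 (c1 g1 - c2 g0) + 2 (M^2 + M - 6) g0^2) / (3 (M + 4) (M + 6) g0^2).
   Here M >= 2, and c1 g1 - c2 g0 is the Dirichlet form of the t-coefficient of
   column v of the adjugate of L + t D, hence positive. *)

Set Implicit Arguments.
Unset Strict Implicit.
Unset Printing Implicit Defensive.

Import Order.TTheory GRing.Theory Num.Theory.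
Local Open Scope ring_scope.

(** * Determinant identities and the pencil of a relation *)

Lemma det_col_scale_add (R : comNzRingType) n (A B : 'M[R]_n) (v : 'I_n) (c s : R) :
    (forall i j, j != v -> B i j = A i j) ->
    (forall i, B i v = c * A i v + s *+ (i == v)) ->
  \det B = c * \det A + s * cofactor A v v.
Proof.
move=> BA Bv; rewrite (expand_det_col B v) (expand_det_col A v).
have cofE i : cofactor B i v = cofactor A i v.
  congr (_ * \det _); apply/matrixP => k l; rewrite !mxE BA //.
  by rewrite eq_sym neq_lift.
under eq_bigr => i _ do rewrite cofE Bv mulrDl.
rewrite big_split mulr_sumr; congr (_ + _).
  by apply: eq_bigr => i _; rewrite -mulrA.
rewrite (bigD1 v) //= eqxx big1 ?addr0 // => i /negPf ->.
by rewrite mulr0n mul0r.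
Qed.

(** The two indexings differ by one permutation acting on rows and columns alike, so its sign occurs
    twice and cancels. *)
Lemma det_reindex (R : comNzRingType) (T : finType) (F : T -> T -> R) m n
    (h : 'I_m -> T) (k : 'I_n -> T) : bijective h -> bijective k ->
  \det (\matrix_(i, j) F (h i) (h j)) = \det (\matrix_(i, j) F (k i) (k j)).
Proof.
move=> bh bk.
have emn : m = n.
  by rewrite -(card_ord m) -(card_ord n) (bij_eq_card bh) (bij_eq_card bk).
case: n / emn k bk => k bk; case: bk => k' kK k'K.
have s_inj : injective (k' \o h).
  by apply: inj_comp; [apply: can_inj k'K | apply: bij_inj].
pose s := perm s_inj.
pose M := \matrix_(i, j) F (k i) (k j).
transitivity (\det (row_perm s (col_perm s M))).
  by congr (\det _); apply/matrixP=> i j; rewrite !mxE !permE /= !k'K.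
rewrite row_permE col_permE !det_mulmx !det_perm odd_permV.
by rewrite mulrCA -signr_addb addbb mulr1.
Qed.

(* [L + 'X D] for the Laplacian [L] and the degree matrix [D]; its determinant
   is [\det D * p('X + 1)] for the characteristic polynomial [p] of [D^-1 A]. *)
Definition pencil (R : comNzRingType) n (E : rel 'I_n) : 'M[{poly R}]_n :=
  \matrix_(i, j) (((1 + 'X) * \sum_k (E i k)%:R) *+ (i == j) - (E i j)%:R).

Lemma det_pencil_reindex (R : comNzRingType) (T : finType) (e : rel T) m n
    (h : 'I_m -> T) (k : 'I_n -> T) : bijective h -> bijective k ->
  \det (pencil R (relpre h e)) = \det (pencil R (relpre k e)).
Proof.
pose F x y : {poly R} := ((1 + 'X) * \sum_z (e x z)%:R) *+ (x == y) - (e x y)%:R.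
have penE l (f : 'I_l -> T) : bijective f ->
    pencil R (relpre f e) = \matrix_(i, j) F (f i) (f j).
  move=> bf; apply/matrixP=> i j; rewrite !mxE /F (inj_eq (bij_inj bf)) /=.
  by rewrite [in RHS](reindex f) //; apply: onW_bij.
by move=> bh bk; rewrite !penE //; apply: det_reindex.
Qed.

(* Multiplying column [v] by the row sum [x + y] of the lower right block and
   adding the last two columns to it makes the matrix block triangular. *)
Lemma det_attach_pair (R : idomainType) n (P : 'M[R]_n) (M : 'M[R]_(n + 2))
    (v : 'I_n) (s x y : R) :
    x + y != 0 ->
    (forall i j, M (lshift 2 i) (lshift 2 j) =
       P i j + s *+ ((i == v) && (j == v))) ->
    (forall i l, M (lshift 2 i) (rshift n l) = - (i == v)%:R) ->
    (forall l i, M (rshift n l) (lshift 2 i) = - (i == v)%:R) ->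
    (forall l m, M (rshift n l) (rshift n m) = if l == m then x else y) ->
  \det M = (x - y) *
    ((x + y) * (\det P + s * cofactor P v v) - cofactor P v v *+ 2).
Proof.
set c := x + y => c_neq0 Mll Mlr Mrl Mrr; set g := cofactor P v v.
pose d : 'rV[R]_n := \row_j (if j == v then c else 1).
pose K := block_mx (diag_mx d) 0 (\matrix_(i, j) (j == v)%:R) (1%:M : 'M_2).
have detK : \det K = c.
  rewrite det_lblock det1 mulr1 det_diag (bigD1 v) //= big1 => [|j /negPf jv].
    by rewrite mxE eqxx mulr1.
  by rewrite mxE jv.
(* The [2%:R] collects the two added columns, each of which is minus the indicator of [v] in the
   upper block. *)
pose M11 := \matrix_(i, j)
  (if j == v then c * P i v + (c * s - 2%:R) *+ (i == v) else P i j).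
have MK : M *m K = block_mx M11 (ursubmx M) 0 (drsubmx M).
  rewrite -[M]submxK mulmx_block !mulmx0 !mulmx1 !add0r block_mxKur block_mxKdr.
  congr block_mx; apply/matrixP=> i j; rewrite mul_mx_diag !mxE.
    rewrite !big_ord_recl big_ord0 !mxE Mll !Mlr.
    case: (j =P v) => [->|_]; case: (i == v); rewrite /= ?mulr1n ?mulr0n; ring.
  rewrite !big_ord_recl big_ord0 !mxE Mrl !Mrr.
  case: (j == v); rewrite /=; last by rewrite !mulr0 oppr0 mul0r !addr0.
  rewrite !mulr1 addr0 mulN1r.
  by case: i => [[|[|//]] li] /=; last rewrite (addrC y); apply: addNr.
have detM11 : \det M11 = c * \det P + (c * s - 2%:R) * g.
  apply: det_col_scale_add => [i j /negPf jv|i]; first by rewrite !mxE jv.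
  by rewrite mxE eqxx.
have detD : \det (drsubmx M) = (x - y) * c.
  rewrite (expand_det_row _ 0) !big_ord_recl big_ord0 /cofactor !det_mx11 !mxE.
  by rewrite !Mrr /= addn0 add0n expr0 expr1 /c; ring.
apply: (mulIf c_neq0).
by rewrite -{1}detK -det_mulmx MK det_ublock detD detM11; ring.
Qed.

(** * Pencil of a graph with two vertices attached at [v] *)

Section AttachPair.
Variables (R : idomainType) (n : nat) (E : rel 'I_n) (v : 'I_n) (b : bool).
Variable E' : rel 'I_(n + 2).
Hypothesis E'll : forall i j, E' (lshift 2 i) (lshift 2 j) = E i j.
Hypothesis E'lr : forall i k, E' (lshift 2 i) (rshift n k) = (i == v).
Hypothesis E'rl : forall k i, E' (rshift n k) (lshift 2 i) = (i == v).
Hypothesis E'rr : forall k l, E' (rshift n k) (rshift n l) = b && (k != l).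

(** A new vertex has degree [b.+1], so the new block has diagonal entries [(1 + 'X) *+ b.+1] and
    off-diagonal entries [- b%:R]. The diagonal entry at [v] grows by [(1 + 'X) *+ 2]. *)
Lemma det_pencil_attach_pair :
  let f := \det (pencil R E) in
  let g := cofactor (pencil R E) v v in
  \det (pencil R E') =
    ((1 + 'X) *+ b.+1 + b%:R) *
    ((1 + 'X *+ b.+1) * (f + (1 + 'X) *+ 2 * g) - g *+ 2).
Proof.
have degl i : \sum_k (E' (lshift 2 i) k)%:R =
    \sum_k (E i k)%:R + (i == v)%:R *+ 2 :> {poly R}.
  rewrite big_split_ord /=; congr (_ + _).
    by apply: eq_bigr => j _; rewrite E'll.
  by rewrite !big_ord_recl big_ord0 !E'lr addr0 mulr2n.
have degr l : \sum_k (E' (rshift n l) k)%:R = b.+1%:R :> {poly R}.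
  rewrite big_split_ord /= (bigD1 v) //= E'rl eqxx.
  rewrite big1 => [|j /negPf jv]; last by rewrite E'rl jv.
  rewrite !big_ord_recl big_ord0 !E'rr !addr0 -natr1 addrC; congr (_ + _).
  by case: l => [[|[|//]] ll]; case: b; rewrite /= ?addr0 ?add0r.
have pll i j : pencil R E' (lshift 2 i) (lshift 2 j) =
    pencil R E i j + ((1 + 'X) *+ 2) *+ ((i == v) && (j == v)).
  rewrite !mxE E'll degl (inj_eq (@lshift_inj _ _)).
  have [<-|ij] := eqVneq i j; last first.
    have -> : (i == v) && (j == v) = false.
      by apply/negbTE; apply: contra ij => /andP[/eqP-> /eqP->].
    by rewrite !mulr0n addr0.
  by case: (i == v); rewrite /= ?mulr1n ?mulr0n; ring.
have plr i l : pencil R E' (lshift 2 i) (rshift n l) = - (i == v)%:R.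
  by rewrite !mxE E'lr eq_lrshift mulr0n sub0r.
have prl l i : pencil R E' (rshift n l) (lshift 2 i) = - (i == v)%:R.
  by rewrite !mxE E'rl eq_rlshift mulr0n sub0r.
have prr l m : pencil R E' (rshift n l) (rshift n m) =
    if l == m then (1 + 'X) *+ b.+1 else - b%:R.
  rewrite !mxE E'rr degr (inj_eq (@rshift_inj _ _)).
  by case: (l == m); rewrite /= ?andbF ?andbT ?subr0 ?sub0r // mulr_natr.
have sumE : (1 + 'X) *+ b.+1 + - b%:R = 1 + 'X *+ b.+1 :> {poly R}.
  by case: b; ring.
rewrite /= (det_attach_pair _ pll plr prl prr) sumE ?opprK //.
(* The row sum of the new block is nonzero because its constant coefficient is 1. *)
apply/eqP=> /(congr1 (fun p : {poly R} => p`_0)) /eqP.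
by rewrite !coefE mul0rn addr0 oner_eq0.
Qed.
End AttachPair.

(** * Laplacian and Dirichlet form *)

Definition laplacian (R : pzRingType) n (E : rel 'I_n) (x : 'I_n -> R)
    (i : 'I_n) : R :=
  \sum_j (E i j)%:R * (x i - x j).

Lemma sum_laplacian (R : numDomainType) n (E : rel 'I_n) (x : 'I_n -> R) :
  symmetric E -> \sum_i laplacian E x i = 0.
Proof.
move=> Es; set S := \sum_i _.
suff SN : S = - S.
  have : S *+ 2 == 0 by rewrite mulr2n {1}SN addNr.
  by rewrite mulrn_eq0 => /eqP.
rewrite {1}/S exchange_big /S -sumrN /=; apply: eq_bigr => i _.
by rewrite -sumrN; apply: eq_bigr => j _; rewrite Es -mulrN opprB.
Qed.

(** The double sum is added to its copy with the two indices swapped. The factor 2 stays on the left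
    since [R] is only a ring. *)
Lemma dirichlet_form (R : comNzRingType) n (E : rel 'I_n) (x : 'I_n -> R) :
    symmetric E ->
  (\sum_i x i * laplacian E x i) *+ 2 =
    \sum_i \sum_j (E i j)%:R * (x i - x j) ^+ 2.
Proof.
move=> Es; pose S := \sum_i \sum_j x i * ((E i j)%:R * (x i - x j)).
have -> : \sum_i x i * laplacian E x i = S.
  by apply: eq_bigr => i _; rewrite mulr_sumr.
have -> : S *+ 2 = S + \sum_i \sum_j x j * ((E i j)%:R * (x j - x i)).
  rewrite mulr2n; congr (_ + _); rewrite /S exchange_big.
  by apply: eq_bigr => i _; apply: eq_bigr => j _; rewrite Es.
rewrite -big_split; apply: eq_bigr => i _; rewrite -big_split.
by apply: eq_bigr => j _ /=; ring.
Qed.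

(** * Low coefficients of the pencil determinant of a connected graph *)

Section ConnectedPencil.
Variables (R : realFieldType) (n : nat) (E : rel 'I_n) (v : 'I_n).
Hypothesis E_sym : symmetric E.
(** Connectedness in the form used with the Dirichlet form: where that form vanishes, the function
    is constant along edges. *)
Hypothesis E_conn : forall x : 'I_n -> R,
  (forall i j, E i j -> x i = x j) -> forall i, x i = x v.

Lemma dirichlet_form_ge0 (x : 'I_n -> R) :
  0 <= \sum_i x i * laplacian E x i.
Proof.
rewrite -(pmulrn_lge0 _ (ltn0Sn 1)) dirichlet_form //.
by do 2![apply: sumr_ge0 => ? _]; rewrite mulr_ge0 ?ler0n ?sqr_ge0.
Qed.

Lemma dirichlet_form_eq0 (x : 'I_n -> R) :
  \sum_i x i * laplacian E x i = 0 -> forall i, x i = x v.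
Proof.
move=> x0; apply: E_conn => i j Eij.
have := dirichlet_form x E_sym; rewrite x0 mul0rn => /esym.
have ge0 k l : 0 <= (E k l)%:R * (x k - x l) ^+ 2.
  by rewrite mulr_ge0 ?ler0n ?sqr_ge0.
move/psumr_eq0P=> /(_ (fun k _ => sumr_ge0 _ (fun l _ => ge0 k l)) i isT).
move/psumr_eq0P=> /(_ (fun l _ => ge0 i l) j isT) /eqP.
by rewrite Eij mul1r sqrf_eq0 subr_eq0 => /eqP.
Qed.

Let deg i : R := \sum_j (E i j)%:R.
Let f := \det (pencil R E).
Let g := cofactor (pencil R E) v v.
(** Column [v] of the adjugate, expanded in powers of ['X]: each coefficient [q k] is a function on
    the vertices, and [q k v] is the coefficient of order [k] of [g]. *)
Let q k i : R := (cofactor (pencil R E) v i)`_k.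

(* Coefficientwise form of column [v] of [P *m \adj P = f%:M], where
   [P = pencil R E]. *)
Let adj_col_coef k i :
  laplacian E (q k) i + deg i * (if k is k'.+1 then q k' i else 0) =
    f`_k *+ (i == v).
Proof.
have := congr1 (fun M : 'M[{poly R}]_n => (M i v)`_k) (mul_mx_adj (pencil R E)).
rewrite !mxE coefMn => <-.
pose Q j := cofactor (pencil R E) v j.
have -> : \sum_j pencil R E i j * (\adj (pencil R E)) j v =
    \sum_j (E i j)%:R * (Q i - Q j) + 'X * ((deg i)%:P * Q i).
  have degE : (deg i)%:P = \sum_j (E i j)%:R :> {poly R}.
    by rewrite rmorph_sum; apply: eq_bigr => j _; rewrite rmorph_nat.
  under eq_bigr => j _ do rewrite !mxE -/(Q j) mulrBl [X in X - _]mulrnAl.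
  rewrite sumrB [X in X - _](bigD1 i) //= eqxx mulr1n.
  rewrite [X in _ + X - _]big1 => [|j]; last first.
    by rewrite eq_sym => /negPf ->.
  under [in RHS]eq_bigr => j _ do rewrite mulrBr.
  rewrite sumrB -mulr_suml degE addr0; ring.
rewrite coefD coefXM coefCM coef_sum; congr (_ + _).
  by apply: eq_bigr => j _; rewrite -polyC_natr coefCM coefB.
by case: k => //=; rewrite mulr0.
Qed.

Let q_prev k i : R := if k is k'.+1 then q k' i else 0.

Let laplacianE k i :
  laplacian E (q k) i = f`_k *+ (i == v) - deg i * q_prev k i.
Proof. by rewrite -(adj_col_coef k) addrK. Qed.

(** Sum [laplacianE] over all vertices: the values of a Laplacian add up to 0. *)
Let det_coef k : f`_k = \sum_i deg i * q_prev k i.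
Proof.
have := @sum_laplacian R _ _ (q k) E_sym.
under eq_bigr => i _ do rewrite laplacianE.
rewrite sumrB (bigD1 v) //= eqxx big1 => [|i /negPf -> //].
by rewrite addr0 => /eqP; rewrite subr_eq0 => /eqP.
Qed.

Lemma det_pencil_coef0 : f`_0 = 0.
Proof. by rewrite det_coef big1 // => i _; rewrite mulr0. Qed.

(** As [f] has no constant term, [q 0] is harmonic, so its Dirichlet form vanishes. *)
Let q0_const i : q 0 i = g`_0.
Proof.
apply: dirichlet_form_eq0; rewrite big1 // => j _.
by rewrite laplacianE det_pencil_coef0 mul0rn !mulr0 subrr mulr0.
Qed.

(** This coefficient counts spanning trees. As the Laplacian is singular, it equals the determinant
    of the Laplacian with 1 added at [(v, v)]. For a vector in the kernel of that matrix, the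
    Dirichlet form plus the squared value at [v] is 0, so the vector is constant and zero at [v]. *)
Lemma cofactor_pencil_coef0_neq0 : g`_0 != 0.
Proof.
pose P0 := \matrix_(i, j) (pencil R E i j)`_0.
pose P1 := \matrix_(i, j) (P0 i j + ((i == v) && (j == v))%:R).
have gE : g`_0 = \det P1.
  rewrite (@det_col_scale_add _ _ P0 P1 v 1 1); first last.
  - by move=> i; rewrite mxE eqxx andbT mul1r.
  - by move=> i j /negPf jv; rewrite mxE jv andbF addr0.
  have P0E : P0 = map_mx (horner_eval 0) (pencil R E).
    by apply/matrixP=> i j; rewrite !mxE /horner_eval horner_coef0.
  have -> : \det P0 = 0.
    by rewrite P0E det_map_mx /= /horner_eval horner_coef0 det_pencil_coef0.
  rewrite P0E cofactor_map_mx /= /horner_eval horner_coef0.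
  by rewrite mulr0 add0r mul1r.
rewrite gE; apply/negP=> /det0P[x x_neq0 xP].
have lapx j : laplacian E (x 0) j + x 0 v *+ (j == v) = 0.
  transitivity ((x *m P1) 0 j); last by rewrite xP mxE.
  rewrite mxE; under [RHS]eq_bigr => i _ do rewrite !mxE mulrDr.
  rewrite big_split /=; congr (_ + _); last first.
    rewrite (bigD1 v) //= eqxx big1 ?addr0 ?mulr_natr // => i /negPf -> /=.
    by rewrite mulr0.
  under [RHS]eq_bigr => i _.
    rewrite coefB coefMn mulrDl mul1r coefD coefXM addr0 -polyC_natr coefC /=.
    rewrite mulrBr E_sym mulrnAr. over.
  rewrite sumrB [X in X - _](bigD1 j) //= eqxx mulr1n.
  rewrite [X in _ + X - _]big1 => [|i /negPf -> //].
  rewrite /laplacian; under [LHS]eq_bigr => i _ do rewrite mulrBr.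
  rewrite sumrB -mulr_suml coef_sum addr0 mulrC; congr (_ * _ - _).
    by apply: eq_bigr => i _; rewrite -polyC_natr coefC.
  by apply: eq_bigr => i _; rewrite mulrC.
have : \sum_j x 0 j * laplacian E (x 0) j + x 0 v ^+ 2 = 0.
  transitivity (\sum_j x 0 j * (laplacian E (x 0) j + x 0 v *+ (j == v))).
    under [RHS]eq_bigr => j _ do rewrite mulrDr.
    rewrite big_split /=; congr (_ + _).
    rewrite (bigD1 v) //= eqxx mulr1n big1 ?addr0 ?expr2 // => j /negPf ->.
    by rewrite mulr0.
  by rewrite big1 // => j _; rewrite lapx mulr0.
move/eqP; rewrite paddr_eq0 ?dirichlet_form_ge0 ?sqr_ge0 // sqrf_eq0.
case/andP=> /eqP /dirichlet_form_eq0 x_const /eqP xv0.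
by case/eqP: x_neq0; apply/rowP => j; rewrite x_const xv0 mxE.
Qed.

Lemma det_pencil_coef1 : f`_1 = (\sum_i deg i) * g`_0.
Proof.
by rewrite det_coef mulr_suml; apply: eq_bigr => i _; rewrite /= q0_const.
Qed.

Hypothesis n_ge2 : (2 <= n)%N.

Lemma pencil_coef_lt : f`_2 * g`_0 < f`_1 * g`_1.
Proof.
(* The Laplacian of [q 1] is c1 times the indicator of [v] minus g0 times the degree; pair it with
   [q 1] and apply [det_coef] at order 2. *)
have DE : \sum_i q 1 i * laplacian E (q 1) i = f`_1 * g`_1 - f`_2 * g`_0.
  under eq_bigr => i _ do rewrite laplacianE mulrBr /= q0_const.
  rewrite sumrB (bigD1 v) //= eqxx big1 => [|i /negPf ->]; last by rewrite mulr0.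
  rewrite addr0 mulrC; congr (_ - _); rewrite det_coef mulr_suml.
  by apply: eq_bigr => i _; rewrite mulrA [q 1 i * _]mulrC.
rewrite lt_neqAle andbC -subr_ge0 -DE dirichlet_form_ge0 /=.
(* Equality would make [q 1] constant, so its Laplacian would vanish and every vertex other than [v]
   would have degree 0. *)
apply/eqP => eqfg.
have q1_const : forall i, q 1 i = q 1 v.
  by apply: dirichlet_form_eq0; rewrite DE eqfg subrr.
have deg0 i : i != v -> deg i = 0.
  move=> /negPf iv; apply: (mulIf cofactor_pencil_coef0_neq0).
  have := laplacianE 1 i; rewrite iv /= q0_const sub0r /laplacian.
  rewrite big1 => [/esym/eqP|j _]; last by rewrite !q1_const subrr mulr0.
  by rewrite oppr_eq0 mul0r => /eqP.
have E0 i j : i != v -> E i j = false.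
  move=> /deg0 /psumr_eq0P => /(_ (fun j _ => ler0n _ _) j isT) /eqP.
  by rewrite pnatr_eq0 eqb0 => /negPf.
(* The indicator of [v] is then constant along edges, hence constant, which leaves [v] as the only
   vertex. *)
have vconst : forall i j, E i j -> (i == v)%:R = (j == v)%:R :> R.
  move=> i j Eij; have [_|/E0 Ei] := eqVneq i v; last by rewrite Ei in Eij.
  by have [//|/E0 Ej] := eqVneq j v; rewrite E_sym Ej in Eij.
have allv i : i = v.
  have := E_conn vconst i; rewrite eqxx => /eqP; rewrite eqr_nat.
  by case: (i =P v).
have := n_ge2; rewrite -[n]card_ord ltnNge => /negP; apply.
by rewrite -(card1 v); apply/subset_leq_card/subsetP => i _; rewrite !inE (allv i).
Qed.
End ConnectedPencil.

(** * The Kemeny constant as a ratio of pencil coefficients *)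

Lemma coef1M (R : nzRingType) (p r : {poly R}) :
  (p * r)`_1 = p`_0 * r`_1 + p`_1 * r`_0.
Proof. by rewrite coefM !big_ord_recl big_ord0 addr0. Qed.

(** Logarithmic derivative of the product at 0. *)
Lemma coef_prod_affine (F : fieldType) (s : seq F)
    (G := \prod_(x <- s) (x%:P + 'X)) :
  G`_0 != 0 -> G`_1 = G`_0 * \sum_(x <- s) x^-1.
Proof.
rewrite {}/G; elim: s => [|x s IHs]; first by rewrite !big_nil mulr0 !coef1.
rewrite !big_cons coef1M coef0M !coefD !coefC !coefX /= addr0 add0r mul1r.
rewrite mulf_eq0 => /norP[x0 /IHs ->].
by rewrite mulrDr mulrAC mulfV // mul1r addrC mulrA.
Qed.

Section KemenyPencil.
Variables (C : numClosedFieldType) (V : finType) (e : rel V).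
Let f := \det (pencil C (relpre enum_val e : rel 'I_#|V|)).

(** The pencil is D times (['X + 1] - T), where D is invertible because every vertex has a
    neighbour. *)
Lemma det_pencil_char_poly : (forall x, exists y, e x y) ->
  f = (\det (degree_mx C e))%:P * (char_poly (transition_mx C e) \Po ('X + 1)).
Proof.
move=> e_total; set D := degree_mx C e; set T := transition_mx C e.
pose d i : C := D i i.
have dE i : d i = \sum_(k < #|V|) (e (enum_val i) (enum_val k))%:R.
  rewrite /d !mxE eqxx mulr1n; apply: eq_bigr => k _.
  by rewrite !mxE mulr1.
have d_neq0 i : d i != 0.
  rewrite dE -natr_sum pnatr_eq0 sum_nat_eq0 negb_forall.
  have [y ey] := e_total (enum_val i).
  by apply/existsP; exists (enum_rank y); rewrite enum_rankK ey eqb0.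
have Ddiag : D = diag_mx (\row_i d i).
  by apply/matrixP=> i j; rewrite /d !mxE eqxx mulr1n.
have D_unit : D \in unitmx.
  rewrite unitmxE unitfE Ddiag det_diag; apply/prodf_neq0 => i _.
  by rewrite mxE.
have DT i j : d i * T i j = (e (enum_val i) (enum_val j))%:R.
  have := congr1 (fun M : 'M[C]_#|V| => M i j) (mulKVmx D_unit (adjacency_mx C e)).
  by rewrite /= -/T {1}Ddiag mul_diag_mx !mxE.
rewrite -det_map_mx /= -[_ \Po _]/(comp_poly _ _) -det_map_mx -det_mulmx.
clearbody T; congr (\det _); apply/matrixP=> i j.
rewrite Ddiag map_diag_mx mul_diag_mx !mxE /=.
rewrite -[X in _ - X = _]polyC_natr -DT.
under eq_bigr => k _ do rewrite -polyC_natr.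
rewrite -rmorph_sum -dE raddfB raddfMn /= comp_polyX comp_polyC polyCM.
by rewrite mulrBr mulrnAr [1 + _]addrC mulrC.
Qed.

(** The shift by 1 turns an eigenvalue [x] into the factor [1 - x + 'X]. The eigenvalue 1 gives a
    factor ['X], which shifts coefficients by one; the remaining product has nonzero constant term,
    so [coef_prod_affine] applies. *)
Lemma kemeny_pencil : (forall x, exists y, e x y) ->
  f`_0 = 0 -> f`_1 != 0 -> kemeny C e = f`_2 / f`_1.
Proof.
move=> /det_pencil_char_poly ->; set a := \det _; rewrite spectrumP rmorph_prod /=.
set s := spectrum _; rewrite /kemeny -/s.
under eq_bigr => x _ do
  rewrite comp_polyB comp_polyX comp_polyC -addrA addrC -polyC1 -polyCB.
rewrite !coefCM => f0 f1.
have s1 : 1 \in s.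
  move/eqP: f0; rewrite mulf_eq0 => /orP[/eqP a0|].
    by rewrite a0 mul0r eqxx in f1.
  rewrite -horner_coef0 horner_prod prodf_seq_eq0 => /hasP[x xs] /=.
  by rewrite !hornerE subr_eq0 => /eqP ->.
move: f1; rewrite (perm_big _ (perm_to_rem s1)) big_cons subrr add0r !coefXM /=.
set G := \prod_(x <- _) _ => aG.
have a_neq0 : a != 0 by apply: contraNneq aG => ->; rewrite mul0r.
have G_neq0 : G`_0 != 0 by apply: contraNneq aG => ->; rewrite mulr0.
have := @coef_prod_affine _ [seq 1 - x | x <- rem 1 s].
rewrite !big_map -/G => /(_ G_neq0) ->.
by field; rewrite a_neq0 G_neq0.
Qed.

(** The positivity arguments need a real field; they are run over [rat] and transferred to [C]. *)
Lemma det_pencil_ratr n (E : rel 'I_n) :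
  \det (pencil C E) = map_poly ratr (\det (pencil rat E)).
Proof.
rewrite -det_map_mx; congr (\det _); apply/matrixP=> i j.
rewrite !mxE rmorphB rmorphMn rmorphM rmorphD rmorph1 /= map_polyX rmorph_nat.
rewrite rmorph_sum /=.
by under [in RHS]eq_bigr => k _ do rewrite rmorph_nat.
Qed.
End KemenyPencil.

(** * The two enlarged graphs and their determinants *)

Section PairIndex.
Variable V : finType.

(** Old vertices come first, so that the pencil splits into the blocks of [det_attach_pair]. *)
Definition pair_index (i : 'I_(#|V| + 2)) : (V + bool)%type :=
  match split i with
  | inl j => inl (enum_val j)
  | inr k => inr (k == ord_max)
  end.

Lemma pair_index_bij : bijective pair_index.
Proof.
apply: inj_card_bij; last by rewrite card_sum card_bool card_ord.
move=> i j; rewrite /pair_index; case: splitP => k ik; case: splitP => l jl //.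
  by case=> /enum_val_inj kl; apply: val_inj; rewrite /= ik jl kl.
case=> kl; apply: val_inj; rewrite /= ik jl; congr (_ + _)%N.
by case: k l kl {ik jl} => [[|[|//]] ?] [[|[|//]] ?].
Qed.

Lemma pair_index_lshift i : pair_index (lshift 2 i) = inl (enum_val i).
Proof. by rewrite /pair_index (unsplitK (inl i)). Qed.

Lemma pair_index_rshift k : pair_index (rshift #|V| k) = inr (k == ord_max).
Proof. by rewrite /pair_index (unsplitK (inr k)). Qed.

End PairIndex.

(** The flag records whether the edge between the new vertices is present, so one computation serves
    both graphs. *)
Definition pair_graph (V : finType) (e : rel V) (v : V) (b : bool) :
    rel (V + bool)%type :=
  if b then hat_graph e v else tilde_graph e v.

Section PairGraph.
Variables (V : finType) (e : rel V) (v : V).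
Hypothesis e_total : forall x, exists y, e x y.

Lemma pair_graph_inlE b x y : pair_graph e v b (inl x) (inl y) = e x y.
Proof.
by case: b; rewrite /pair_graph /hat_graph /tilde_graph /add_edge /=
  !andbF !orbF.
Qed.

Lemma pair_graph_inlrE b x k : pair_graph e v b (inl x) (inr k) = (x == v).
Proof.
by case: b k => [] []; rewrite /pair_graph /hat_graph /tilde_graph /add_edge /=
  ?andbF ?andbT ?orbF.
Qed.

Lemma pair_graph_inrlE b k x : pair_graph e v b (inr k) (inl x) = (x == v).
Proof.
by case: b k => [] []; rewrite /pair_graph /hat_graph /tilde_graph /add_edge /=
  ?andbF ?andbT ?orbF.
Qed.

Lemma pair_graph_inrE b k l : pair_graph e v b (inr k) (inr l) = b && (k != l).
Proof. by case: b k l => [] [] []. Qed.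

Lemma pair_graph_total b x : exists y, pair_graph e v b x y.
Proof.
case: x => [x|k]; last by exists (inl v); rewrite pair_graph_inrlE.
by have [y exy] := e_total x; exists (inl y); rewrite pair_graph_inlE.
Qed.

Let f := \det (pencil rat (relpre enum_val e : rel 'I_#|V|)).
Let g := cofactor (pencil rat (relpre enum_val e : rel 'I_#|V|))
           (enum_rank v) (enum_rank v).

Lemma det_pencil_pair_graph b :
  \det (pencil rat (relpre (@pair_index V) (pair_graph e v b))) =
    ((1 + 'X) *+ b.+1 + b%:R) *
    ((1 + 'X *+ b.+1) * (f + (1 + 'X) *+ 2 * g) - g *+ 2).
Proof.
have rankE (i : 'I_#|V|) : (i == enum_rank v) = (enum_val i == v).
  by rewrite -(inj_eq enum_val_inj) enum_rankK.
rewrite (@det_pencil_attach_pair _ _ (relpre enum_val e) (enum_rank v) b) //.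
- by move=> i j; rewrite /= !pair_index_lshift pair_graph_inlE.
- move=> i k; rewrite /= pair_index_lshift pair_index_rshift.
  by rewrite pair_graph_inlrE rankE.
- move=> k i; rewrite /= pair_index_lshift pair_index_rshift.
  by rewrite pair_graph_inrlE rankE.
- move=> k l; rewrite /= !pair_index_rshift pair_graph_inrE.
  by congr (_ && ~~ _); case: k l => [[|[|//]] ?] [[|[|//]] ?].
Qed.

Lemma kemeny_pair_graph (C : numClosedFieldType) b
    (F := \det (pencil rat (relpre (@pair_index V) (pair_graph e v b)))) :
  F`_0 = 0 -> F`_1 != 0 -> kemeny C (pair_graph e v b) = ratr (F`_2 / F`_1).
Proof.
move=> F0 F1.
pose G : rel 'I_#|{: V + bool}| := relpre enum_val (pair_graph e v b).
have FE : \det (pencil C G) = map_poly ratr F.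
  rewrite -det_pencil_ratr.
  exact: (det_pencil_reindex _ _ (enum_val_bij _) (pair_index_bij V)).
rewrite kemeny_pencil; first by rewrite FE !coef_map fmorph_div.
- exact: pair_graph_total.
- by rewrite FE coef_map F0 raddf0.
- by rewrite FE coef_map fmorph_eq0.
Qed.

End PairGraph.

Lemma coef_low_orders (R : nzRingType) (p r s : {poly R})
    (F := p + 'X * r + 'X * ('X * s)) :
  [/\ F`_0 = p`_0, F`_1 = p`_1 + r`_0 & F`_2 = p`_2 + r`_1 + s`_0].
Proof. by rewrite /F !(coefD, coefXM) /= !addr0. Qed.

(** * Comparison of the two Kemeny constants *)

Theorem theorem2p2 (C : numClosedFieldType) (V : finType) (e : rel V)
    (e_sym : symmetric e) (e_irr : irreflexive e)
    (e_conn : connected_graph e) (V_ge2 : (2 <= #|V|)%N) (v : V) :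
  kemeny C (hat_graph e v) > kemeny C (tilde_graph e v).
Proof.
have e_total x : exists y, e x y.
  have [y yx] : exists y, y != x.
    apply/existsP; rewrite -negb_forall; apply: contraL V_ge2 => /forallP xx.
    rewrite -ltnNge ltnS -(card1 x); apply/subset_leq_card/subsetP=> y _.
    exact: xx.
  have /connectP[[|z p] /= ep yp] := e_conn x y; first by rewrite yp eqxx in yx.
  by exists z; case/andP: ep.
pose E : rel 'I_#|V| := relpre enum_val e; pose w : 'I_#|V| := enum_rank v.
have E_sym : symmetric E by move=> i j; apply: e_sym.
have E_conn (x : 'I_#|V| -> rat) :
    (forall i j, E i j -> x i = x j) -> forall i, x i = x w.
  (* The level set of [x] through [w] is closed under adjacency, so it contains every vertex. *)
  move=> xE i; pose a := [pred y | x (enum_rank y) == x w].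
  have a_closed : closed e a.
    move=> y z eyz; rewrite !inE (xE _ (enum_rank z)) //.
    by rewrite /E /= !enum_rankK.
  have := closed_connect a_closed (e_conn (enum_val i) v).
  by rewrite !inE enum_valK eqxx => /eqP.
pose f := \det (pencil rat E); pose g := cofactor (pencil rat E) w w.
have f0 : f`_0 = 0 := det_pencil_coef0 rat w E_sym.
have g0 : g`_0 != 0 := cofactor_pencil_coef0_neq0 E_sym E_conn.
have f1 : f`_1 = _ * g`_0 := det_pencil_coef1 E_sym E_conn.
have fg : f`_2 * g`_0 < f`_1 * g`_1 := pencil_coef_lt E_sym E_conn V_ge2.
move: f1; set M := \sum_i _ => f1.
have M_ge2 : 2 <= M.
  have deg_ge1 i : 1 <= \sum_j (E i j)%:R :> rat.
    have [y ey] := e_total (enum_val i).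
    rewrite -natr_sum ler1n (bigD1 (enum_rank y)) //= {1}/E /= enum_rankK ey.
    by rewrite add1n.
  apply: le_trans (_ : #|V|%:R <= _); first by rewrite ler_nat.
  rewrite -[in X in X <= _](card_ord #|V|) -sum1_card natr_sum.
  exact: ler_sum.
have tildeE := det_pencil_pair_graph e v false.
have hatE := det_pencil_pair_graph e v true.
have {}tildeE : \det (pencil rat (relpre (@pair_index V) (tilde_graph e v))) =
   f + 'X * (f *+ 2 + g *+ 4) + 'X * ('X * (f + g *+ 6 + 'X * (g *+ 2))).
  by rewrite tildeE -/E -/f -/w -/g /=; ring.
have {}hatE : \det (pencil rat (relpre (@pair_index V) (hat_graph e v))) =
   f *+ 3 + 'X * (f *+ 8 + g *+ 18)
   + 'X * ('X * (f *+ 4 + g *+ 24 + 'X * (g *+ 8))).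
  by rewrite hatE -/E -/f -/w -/g /=; ring.
have M4 : M + 4 != 0 by rewrite gt_eqF //; lra.
have M6 : M + 6 != 0 by rewrite gt_eqF //; lra.
(* In the denominators, M + 4 and M + 6 are the degree sums of the new graphs, and the factor 3
   counts the spanning trees of the added triangle. *)
have lt_coef : (f`_2 + 2 * (M * g`_0) + 4 * g`_1 + 6 * g`_0) / ((M + 4) * g`_0)
    < (3 * f`_2 + 8 * (M * g`_0) + 18 * g`_1 + 24 * g`_0) /
      (3 * ((M + 6) * g`_0)).
  rewrite -subr_gt0; move: fg g0; rewrite f1.
  move: g`_0 g`_1 f`_2 => a b c fg a0.
  rewrite (_ : _ - _ = (6 * (M * a * b - c * a) + 2 * (M ^+ 2 + M - 6) * a ^+ 2)
    / (3 * (M + 4) * (M + 6) * a ^+ 2)); last by field; rewrite a0 M4 M6.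
  have a2 : 0 < a ^+ 2 by rewrite exprn_even_gt0.
  (* The polynomial factors as (M - 2)(M + 3). It vanishes at M = 2, so strictness comes from
     [fg]. *)
  have M2 : 0 <= M ^+ 2 + M - 6 by nra.
  have num : 0 <= (M ^+ 2 + M - 6) * a ^+ 2 by rewrite mulr_ge0 // ltW.
  by apply: divr_gt0; [lra | rewrite pmulr_rgt0 // !mulr_gt0 //; lra].
have kemeny_tilde : kemeny C (tilde_graph e v) =
    ratr ((f`_2 + 2 * (M * g`_0) + 4 * g`_1 + 6 * g`_0) / ((M + 4) * g`_0)).
  have [] := coef_low_orders f
    (f *+ 2 + g *+ 4) (f + g *+ 6 + 'X * (g *+ 2)).
  rewrite -tildeE !(coefD, coefMn) coefXM f0 f1 eqxx => F0 F1 F2.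
  have {}F0 : (\det (pencil rat (relpre (@pair_index V) (tilde_graph e v))))`_0 = 0.
    by rewrite F0 ?mul0rn.
  rewrite -[tilde_graph e v]/(pair_graph e v false).
  rewrite (@kemeny_pair_graph _ _ _ e_total _ false F0) /= ?F1 ?F2.
    by congr (ratr (_ / _)); ring.
  apply: contraNneq M4 => F1_0; apply/eqP/(mulIf g0).
  by rewrite mul0r; lra.
have kemeny_hat : kemeny C (hat_graph e v) =
    ratr ((3 * f`_2 + 8 * (M * g`_0) + 18 * g`_1 + 24 * g`_0) /
          (3 * ((M + 6) * g`_0))).
  have [] := coef_low_orders (f *+ 3)
    (f *+ 8 + g *+ 18) (f *+ 4 + g *+ 24 + 'X * (g *+ 8)).
  rewrite -hatE !(coefD, coefMn) coefXM f0 f1 eqxx => F0 F1 F2.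
  have {}F0 : (\det (pencil rat (relpre (@pair_index V) (hat_graph e v))))`_0 = 0.
    by rewrite F0 ?mul0rn.
  rewrite -[hat_graph e v]/(pair_graph e v true).
  rewrite (@kemeny_pair_graph _ _ _ e_total _ true F0) /= ?F1 ?F2.
    by congr (ratr (_ / _)); ring.
  apply: contraNneq M6 => F1_0; apply/eqP/(mulIf g0).
  by rewrite mul0r; lra.
by rewrite kemeny_tilde kemeny_hat ltr_rat.
Qed.
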